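(* Let $k=4k'+1$ for some $k'\in\mathbb{N}$ (so $k'\ge 1$), and consider the system \[ x_{n+1} =\frac{1}{y_{n-k}}, \qquad y_{n+1}=\frac{y_{n-k}}{x_{n-1}\,y_{n-1}}, \qquad n=0,1,2,\ldots, \] where $x_{-1}, x_0, y_{-(4k'+1)},\ldots,y_{-1},y_0$ are nonzero real numbers such that $A:=x_0y_0\neq 1$ or $B:=x_{-1}y_{-1}\neq 1$. Let $\rho:=4(2k'+1)$, $\Omega_1:=\{1,2,\ldots,4k'+2\}$ and $\Omega_2:=\{4k'+3,4k'+4,\ldots,\rho\}$. For each $n\geq 1$ let $s\in\{1,2,\ldots,\rho\}$ be the integer with $s\equiv n \pmod{\rho}$. Then every solution of the system satisfies, for all $n=1,2,\ldots$, \[ x_n = \begin{cases} \dfrac{1}{y_{-(4k'+2)+s}}, & \text{if } s\in\Omega_1,\\[1em] \dfrac{A^{\xi(s)}B^{-\xi(s-1)}}{y_{-2(4k'+2)+s}}, & \text{if } s\in\Omega_2, \end{cases} \] and \[ y_n = \begin{cases} \dfrac{y_{-(4k'+2)+s}}{A^{-\xi(s)}B^{\xi(s-1)}}, & \text{if } s\in\Omega_1,\\[1em] y_{-2(4k'+2)+s}, & \text{if } s\in\Omega_2. \end{cases} \]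
   Context: For an integer $n\ge 0$, $\xi(n):=\dfrac{i^n+(-i)^n}{2}$ with $i=\sqrt{-1}$; that is, $\xi(n)=1$ if $n\equiv 0 \pmod 4$, $\xi(n)=-1$ if $n\equiv 2\pmod 4$, and $\xi(n)=0$ if $n$ is odd. *)

(* Defs.v *)
From mathcomp Require Import all_boot all_order all_algebra all_field.
From mathcomp Require Import reals.
Set Implicit Arguments.
Unset Strict Implicit.
Unset Printing Implicit Defensive.
Import Order.TTheory GRing.Theory Num.Theory.
Local Open Scope ring_scope.

(* xi is int-valued so that it can be used as an exponent; xiE shows that it is
   (i^n + (-i)^n) / 2. *)
Definition xi (n : nat) : int :=
  if (n %% 4 == 0)%N then 1 else if (n %% 4 == 2)%N then -1 else 0.

Lemma xiE (n : nat) : (xi n)%:~R = ('i ^+ n + (- 'i) ^+ n) / 2 :> algC.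
Proof.
have xi4 : xi n = xi (n %% 4) by rewrite /xi modn_mod.
have sq2 (z : algC) : z ^+ 2 = -1 -> z ^+ n = z ^+ (n %% 4).
  move=> z2; rewrite {1}(divn_eq n 4) exprD mulnC (exprM z 4) (exprM z 2 2) z2.
  by rewrite sqrrN !expr1n mul1r.
rewrite xi4 (sq2 'i) ?sqrCi // (sq2 (- 'i)) ?sqrrN ?sqrCi //.
have two_neq0 : 2 != 0 :> algC by rewrite pnatr_eq0.
have := ltn_pmod n (isT : 0 < 4)%N.
move: (n %% 4)%N => r; do 4?[case: r => [|r] //] => _.
- by rewrite !expr0 divff.
- by rewrite !expr1 subrr mul0r.
- by rewrite sqrrN sqrCi -opprD mulNr divff.
- by rewrite !(exprS _ 2) sqrrN mulNr subrr mul0r.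
Qed.

(* Main.v *)
Require Import Defs.
From mathcomp Require Import all_boot all_order all_algebra all_field.
From mathcomp Require Import reals.
From mathcomp Require Import zify.
Set Implicit Arguments.
Unset Strict Implicit.
Unset Printing Implicit Defensive.
Import Order.TTheory GRing.Theory Num.Theory.
Local Open Scope ring_scope.

(** Multiplying the two equations of the system makes y_(n-k) cancel, so that
   the products z_n = x_n y_n satisfy z_(n+1) = 1 / z_(n-1): they are
   determined by A = z_0 and B = z_(-1), and shifting the index by 2 inverts
   them (lemma [prod_sol]; its [alternant] A B n is z_(n-1)).  Once z is known,
   the second equation reads y_(n+1) = y_(n-k) / z_(n-1), which is linear with
   known coefficients and moves the index by m := k + 1 = 4k' + 2.  Because m is
   2 modulo 4, the factors met in two consecutive steps of length m are inverse
   to each other, whence y_(n+2m) = y_n (lemma [y_two_steps]).  As x is the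
   inverse of y shifted by m, it inherits the period rho = 2m ([sol_periodic]),
   and it suffices to read the formulas for 1 <= n <= 2m: one step of length m
   reaches the initial values of y from Omega_1, two steps from Omega_2. *)

Definition is_solution (F : fieldType) (k : nat) (x y : int -> F) : Prop :=
  forall n : nat, x (n%:Z + 1) = 1 / y (n%:Z - k%:Z) /\
    y (n%:Z + 1) = y (n%:Z - k%:Z) / (x (n%:Z - 1) * y (n%:Z - 1)).

(** The sequence B, A, 1/B, 1/A, B, ...  The index starts one step before that
   of the system so that it is a natural number; [alternant] A B (s - 1) is then
   the very expression that the closed form carries at time s. *)
Definition alternant (F : fieldType) (A B : F) (n : nat) : F :=
  A ^ (- xi n.+1) * B ^ (xi n).

Lemma xi_add2 (n : nat) : xi n.+2 = - xi n.
Proof.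
rewrite /xi -addn2 -modnDml; have := ltn_pmod n (isT : 0 < 4)%N.
by move: (n %% 4)%N => r; do 4?[case: r => [|r] //].
Qed.

Lemma alternant_add2 (F : fieldType) (A B : F) (n : nat) :
  alternant A B n.+2 = (alternant A B n)^-1.
Proof. by rewrite /alternant !xi_add2 invfM !invr_expz. Qed.

Lemma alternant_add4 (F : fieldType) (A B : F) (n q : nat) :
  alternant A B (n + 4 * q) = alternant A B n.
Proof.
elim: q => [|q IHq]; first by rewrite muln0 addn0.
by rewrite mulnS addnCA !alternant_add2 invrK.
Qed.

Lemma alternant_add42 (F : fieldType) (A B : F) (n q : nat) :
  alternant A B (n + (4 * q + 2)) = (alternant A B n)^-1.
Proof. by rewrite addnA addn2 alternant_add2 alternant_add4. Qed.

Lemma alternant_neq0 (F : fieldType) (A B : F) (n : nat) :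
  A != 0 -> B != 0 -> alternant A B n != 0.
Proof. by move=> A0 B0; rewrite mulf_neq0 ?expfz_neq0. Qed.

(** The product formula and the fact that y never vanishes feed each other: the
   cancellation of y_(n-k) needs it nonzero, and y_(n+1) is nonzero because the
   product dividing y_(n-k) is known to be so.  Hence a joint induction, over
   two consecutive products since the recurrence for them has order 2. *)
Lemma prod_sol (F : fieldType) (k : nat) (x y : int -> F) (n : nat) :
    is_solution k x y ->
    x 0 != 0 -> x (- 1) != 0 -> (0 < k)%N ->
    (forall j : nat, (j <= k)%N -> y (- j%:Z) != 0) ->
  [/\ forall j : nat, (j <= n + k)%N -> y (j%:Z - k%:Z) != 0,
      x (n%:Z - 1) * y (n%:Z - 1)
        = alternant (x 0 * y 0) (x (- 1) * y (- 1)) n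
    & x n%:Z * y n%:Z = alternant (x 0 * y 0) (x (- 1) * y (- 1)) n.+1].
Proof.
move=> sol x0 xm1 k_gt0 y_init.
have A0 : x 0 * y 0 != 0 by rewrite mulf_neq0 //; apply: (y_init 0%N).
have B0 : x (- 1) * y (- 1) != 0 by rewrite mulf_neq0 //; apply: (y_init 1%N).
elim: n => [|n [y_neq0 zn zn1]].
  split=> [j le_jk||].
  - by have := y_init (k - j)%N (leq_subr _ _); congr (y _ != 0); lia.
  - by rewrite sub0r /alternant /xi /= oppr0 expr0z mul1r expr1z.
  - by rewrite /alternant /xi /= opprK expr0z mulr1 expr1z.
have [xS yS] := sol n.
have ynk0 : y (n%:Z - k%:Z) != 0 by apply: y_neq0; rewrite leq_addr.
have -> : n.+1%:Z = n%:Z + 1 by lia.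
split=> [j||].
- rewrite addSn leq_eqVlt => /predU1P[-> | /y_neq0 //].
  have -> : (n + k).+1%:Z - k%:Z = n%:Z + 1 by lia.
  by rewrite yS zn mulf_neq0 // invr_neq0 // alternant_neq0.
- by rewrite addrK.
- by rewrite xS yS mulrA div1r mulVf // mul1r zn -alternant_add2.
Qed.

(** The factors of the two steps cancel because [alternant] is inverted by a
   shift of 4q + 2. *)
Lemma y_two_steps (F : fieldType) (k q : nat) (A B : F) (y : int -> F) :
    k = (4 * q + 1)%N -> A != 0 -> B != 0 ->
    (forall n : nat, y (n%:Z + 1) = y (n%:Z - k%:Z) / alternant A B n) ->
  forall n : nat, y ((n + k.+1)%:Z + 1) = y (n%:Z - k%:Z).
Proof.
move=> def_k A0 B0 y_step n; rewrite y_step.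
have -> : (n + k.+1)%:Z - k%:Z = n%:Z + 1 by lia.
have -> : k.+1 = (4 * q + 2)%N by lia.
by rewrite y_step alternant_add42 invrK divfK ?alternant_neq0.
Qed.

Lemma sol_periodic (F : fieldType) (k : nat) (x y : int -> F) (n q : nat) :
    is_solution k x y ->
    (forall n : nat, y ((n + k.+1)%:Z + 1) = y (n%:Z - k%:Z)) ->
  x ((n + q * (2 * k.+1))%:Z + 1) = x (n%:Z + 1) /\
  y ((n + q * (2 * k.+1))%:Z + 1) = y (n%:Z + 1).
Proof.
move=> sol y_per.
have y_shift i : y ((i + q * (2 * k.+1))%:Z - k%:Z) = y (i%:Z - k%:Z).
  elim: q i => [|q IHq] i; first by rewrite mul0n addn0.
  rewrite mulSn addnA IHq -[RHS]y_per; congr y; lia.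
split; first by rewrite !(sol _).1 y_shift.
have yE i : y (i%:Z + 1) = y ((i + k.+1)%:Z - k%:Z) by congr y; lia.
by rewrite !yE addnAC y_shift.
Qed.

Theorem theorem5 (R : realType) (k' k rho : nat)
  (k'_gt0 : (0 < k')%N) (def_k : k = (4 * k' + 1)%N)
  (def_rho : rho = (4 * (2 * k' + 1))%N)
  (* x_n is only relevant for n >= -1, and y_n for n >= -k *)
  (x y : int -> R)
  (x0_neq0 : x 0 <> 0) (xm1_neq0 : x (- 1) <> 0)
  (y_init_neq0 : forall j : nat, (j <= 4 * k' + 1)%N -> y (- j%:Z) <> 0)
  (x_rec : forall n : nat, x (n%:Z + 1) = 1 / y (n%:Z - k%:Z))
  (y_rec : forall n : nat,
     y (n%:Z + 1) = y (n%:Z - k%:Z) / (x (n%:Z - 1) * y (n%:Z - 1)))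
  (A B : R) (def_A : A = x 0 * y 0) (def_B : B = x (- 1) * y (- 1))
  (AB_neq1 : A <> 1 \/ B <> 1)
  (n s : nat) (n_gt0 : (1 <= n)%N)
  (s_range : (1 <= s <= rho)%N) (s_mod : s = n %[mod rho]) :
  ((1 <= s <= 4 * k' + 2)%N ->
     x n%:Z = 1 / y (- (4 * k' + 2)%N%:Z + s%:Z) /\
     y n%:Z = y (- (4 * k' + 2)%N%:Z + s%:Z)
              / (A ^ (- xi s) * B ^ (xi (s - 1)%N))) /\
  ((4 * k' + 3 <= s <= rho)%N ->
     x n%:Z = A ^ (xi s) * B ^ (- xi (s - 1)%N)
              / y (- (2 * (4 * k' + 2))%N%:Z + s%:Z) /\
     y n%:Z = y (- (2 * (4 * k' + 2))%N%:Z + s%:Z)).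
Proof.
have sol : is_solution k x y by move=> i; split.
have x0 : x 0 != 0 by apply/eqP.
have xm1 : x (- 1) != 0 by apply/eqP.
have y_init (j : nat) : (j <= k)%N -> y (- j%:Z) != 0.
  by rewrite def_k => le_jk; apply/eqP/y_init_neq0.
have k_gt0 : (0 < k)%N by lia.
have A0 : A != 0 by rewrite def_A mulf_neq0 //; apply: (y_init 0%N).
have B0 : B != 0 by rewrite def_B mulf_neq0 //; apply: (y_init 1%N).
have y_step (i : nat) : y (i%:Z + 1) = y (i%:Z - k%:Z) / alternant A B i.
  by have [_ zi _] := prod_sol i sol x0 xm1 k_gt0 y_init; rewrite y_rec zi def_A def_B.
have y_per := y_two_steps def_k A0 B0 y_step.
have rhoE : rho = (2 * k.+1)%N by lia.
case: n s n_gt0 s_range s_mod => [//|n] [//|s] _ /andP[_ s_lt] /eqP s_mod.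
have {s_mod} nE : n = (s + n %/ rho * rho)%N.
  move: s_mod; rewrite -addn1 -[n.+1]addn1 eqn_modDr (modn_small s_lt) => /eqP {1}->.
  by rewrite addnC -divn_eq.
have [xn yn] := sol_periodic s (n %/ rho) sol y_per.
rewrite -rhoE -nE in xn yn.
have -> : n.+1%:Z = n%:Z + 1 by lia.
rewrite {}xn {}yn subn1 /=; split=> s_bnd.
  have -> : - (4 * k' + 2)%N%:Z + s.+1%:Z = s%:Z - k%:Z by lia.
  by rewrite x_rec y_step.
(* In Omega_2 the time s + 1 is t + 1 + m, with t + 1 a time in Omega_1. *)
have [t def_s] : exists t, s = (t + k.+1)%N by exists (s - k.+1)%N; lia.
have -> : - (2 * (4 * k' + 2))%N%:Z + s.+1%:Z = t%:Z - k%:Z by lia.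
have -> : A ^ xi s.+1 * B ^ (- xi s) = alternant A B t.
  have -> : A ^ xi s.+1 * B ^ (- xi s) = (alternant A B s)^-1.
    by rewrite /alternant invfM !invr_expz opprK.
  have -> : s = (t + (4 * k' + 2))%N by lia.
  by rewrite alternant_add42 invrK.
rewrite {}def_s y_per x_rec; split=> //.
have -> : (t + k.+1)%:Z - k%:Z = t%:Z + 1 by lia.
by rewrite y_step div1r invfM invrK mulrC.
Qed.
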